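(* Let $\Omega\subset\mathbb{R}^n$ be a non-empty, bounded, open set and let $E,F\subset\mathbb{R}^m\times\mathbb{R}^m$ be closed. Then $\mathcal A_E=\mathcal A_F$ if and only if $\widehat E=\widehat F$. In particular, $\mathcal A_E=\mathcal A_{\widehat E}$.
   Context: For $E\subset\mathbb{R}^m\times\mathbb{R}^m$, $\mathcal A_E:=\{u\in L^\infty(\Omega;\mathbb{R}^m): (u(x),u(y))\in E \text{ for a.e. }(x,y)\in\Omega\times\Omega\}$, and $\widehat E:=\{(\xi,\zeta)\in E:(\xi,\xi),(\zeta,\xi),(\zeta,\zeta)\in E\}$ is the symmetrization and diagonalization of $E$. *)

(* Defs.v *)
From HB Require Import structures.
From mathcomp Require Import all_boot all_order all_algebra.
From mathcomp Require Import all_classical all_reals all_analysis.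
From mathcomp Require Import measurable_realfun.

Set Implicit Arguments.
Unset Strict Implicit.
Unset Printing Implicit Defensive.

Import Order.TTheory GRing.Theory Num.Theory.
Import numFieldNormedType.Exports.

Local Open Scope classical_set_scope.
Local Open Scope ring_scope.

Definition rV_borel_display : measure_display.
Proof. exact: default_measure_display. Qed.

Section rV_borel.
Context (R : realType) (n : nat).

Let borel0 : <<s @open 'rV[R]_n >> set0.
Proof. exact: sigma_algebra0. Qed.

Let borelC A : <<s @open 'rV[R]_n >> A -> <<s @open 'rV[R]_n >> (~` A).
Proof. exact: sigma_algebraC. Qed.

Let borel_bigcup (F : (set 'rV[R]_n)^nat) :
  (forall i, <<s @open 'rV[R]_n >> (F i)) ->
  <<s @open 'rV[R]_n >> (\bigcup_i (F i)).
Proof. exact: sigma_algebra_bigcup. Qed.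

HB.instance Definition _ := @isMeasurable.Build rV_borel_display
  'rV[R]_n <<s @open 'rV[R]_n >> borel0 borelC borel_bigcup.

End rV_borel.

Section rV_borel_lemmas.
Context (R : realType).

Lemma open_measurable_rV n (A : set 'rV[R]_n) : open A -> measurable A.
Proof. exact: sub_sigma_algebra. Qed.

Lemma measurable_coord_rV n (i : 'I_n) :
  measurable_fun setT (fun x : 'rV[R]_n => x ord0 i).
Proof.
apply: (measurability _ (RGenOpens.measurableE R)) => /= _ [_ [a [b ->] <-]].
rewrite setTI; apply: open_measurable_rV.
apply: open_comp; last exact: interval_open.
by move=> x _; exact: coord_continuous.
Qed.

Lemma open_rV_rat_ball n (U : set 'rV[R]_n) (x : 'rV[R]_n) : open U -> U x ->
  exists (q : 'rV[rat]_n) (r : rat),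
    ball (map_mx ratr q : 'rV[R]_n) (ratr r) x /\
    ball (map_mx ratr q : 'rV[R]_n) (ratr r) `<=` U.
Proof.
move=> oU Ux.
have /nbhs_ballP[e /= e0 eU] : nbhs x U by exact: open_nbhs_nbhs.
have [r] : exists r : rat, (ratr r : R) \in `]0, e / 2[.
  by apply: rat_in_itvoo; rewrite divr_gt0.
rewrite in_itv/= => /andP[r0 re].
have qP i : exists p : rat, `|x ord0 i - ratr p| < ratr r.
  have [p] : exists p : rat, ratr p \in `](x ord0 i - ratr r), (x ord0 i + ratr r)[.
    by apply: rat_in_itvoo; rewrite ltrD2l gtrN.
  rewrite in_itv/= => /andP[p1 p2]; exists p.
  by rewrite ltr_distlC p1 p2.
have [g gP] := choice qP.
pose q : 'rV[rat]_n := \row_i g i.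
have qx : ball (map_mx ratr q : 'rV[R]_n) (ratr r) x.
  by split => // i j; rewrite !mxE ord1 /ball/= distrC; exact: gP.
exists q, r; split => // y qy; apply: eU.
apply: (@le_ball _ _ _ (ratr r + ratr r)).
  by rewrite (splitr e) lerD// ltW.
by apply: ball_triangle qy; exact: ball_sym.
Qed.

Lemma measurable_fun_rVP d (T : measurableType d) n (f : T -> 'rV[R]_n) :
  (forall i, measurable_fun setT (fun t => f t ord0 i)) ->
  measurable_fun setT f.
Proof.
move=> mf; apply: (measurability (@open 'rV[R]_n)) => // _ [U oU <-].
rewrite setTI.
pose B (z : 'rV[rat]_n * rat) : set 'rV[R]_n := 
  ball (map_mx ratr z.1 : 'rV[R]_n) (ratr z.2).
pose D := [set z | B z `<=` U].
have -> : U = \bigcup_z (if `[< D z >] then B z else set0).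
  apply/seteqP; split=> [x Ux|x [z _]].
    have [q [r [qx qU]]] := open_rV_rat_ball oU Ux.
    by exists (q, r) => //; rewrite ifT //; apply/asboolP.
  by case: ifPn => // /asboolP Dz /Dz.
rewrite preimage_bigcup; apply: countable_bigcupT_measurable => // z.
case: ifPn => _; last by rewrite preimage_set0.
have [r0|r0] := ltP 0 (ratr z.2 : R); last first.
  rewrite (_ : _ @^-1` _ = set0)//; apply/seteqP; split => // t [].
  by rewrite ltNge r0.
rewrite (_ : _ @^-1` _ =
    \bigcap_(i in setT) ((fun t => f t ord0 i) @^-1` 
      ball (ratr (z.1 ord0 i) : R) (ratr z.2))).
  apply: fin_bigcap_measurable => // i _.
  by rewrite -[X in measurable X]setTI; apply: mf => //; exact: measurable_ball.
apply/seteqP; split=> t /=.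
  by move=> [_ h] i _; have := h ord0 i; rewrite mxE.
by move=> h; split=> // i j; rewrite mxE ord1; exact: h.
Qed.

Definition rV_cons n (p : R * 'rV[R]_n) : 'rV[R]_n.+1 :=
  row_mx (p.1%:M : 'rV_1) p.2.

Lemma rV_cons0 n (p : R * 'rV[R]_n) : rV_cons p ord0 ord0 = p.1.
Proof.
have -> : ord0 = @lshift 1 n ord0 :> 'I_n.+1 by exact/val_inj.
by rewrite [LHS]row_mxEl mxE.
Qed.

Lemma rV_consS n (p : R * 'rV[R]_n) (i : 'I_n) :
  rV_cons p ord0 (lift ord0 i) = p.2 ord0 i.
Proof.
have -> : lift ord0 i = rshift 1 i :> 'I_n.+1 by exact/val_inj.
exact: row_mxEr.
Qed.

Lemma measurable_rV_cons n : measurable_fun setT (@rV_cons n).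
Proof.
apply: measurable_fun_rVP => i.
have [->|[j ->]] : i = ord0 \/ exists j, i = lift ord0 j.
  by case: (unliftP ord0 i) => [j ->|->]; [right; exists j|left].
  by under eq_fun do rewrite rV_cons0; exact: measurable_fst.
under eq_fun do rewrite rV_consS.
exact: (measurableT_comp (measurable_coord_rV j) measurable_snd).
Qed.

End rV_borel_lemmas.

Section lebesgue_rV.
Context (R : realType).
Local Open Scope ereal_scope.

(* Lebesgue measure on R^n is the n-fold product of the Lebesgue measure on R
   (see [lebesgue_rV_box] for the values on boxes); R^0 is a point of mass 1 *)
Fixpoint lebesgue_rV (n : nat) : set 'rV[R]_n -> \bar R :=
  match n with
  | 0 => \d_(0%R : 'rV[R]_0)
  | n'.+1 => pushforward (@lebesgue_measure R \x @lebesgue_rV n') (@rV_cons R n')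
  end.

Let rV_uncons n (x : 'rV[R]_n.+1) : R * 'rV[R]_n :=
  (x ord0 ord0, \row_i x ord0 (lift ord0 i)).

Let measurable_rV_uncons n : measurable_fun setT (@rV_uncons n).
Proof.
apply/measurable_fun_pair; first exact: measurable_coord_rV.
apply: measurable_fun_rVP => i; under eq_fun do rewrite mxE.
exact: measurable_coord_rV.
Qed.

Let rV_consK n : cancel (@rV_cons R n) (@rV_uncons n).
Proof.
move=> [a v]; rewrite /rV_uncons rV_cons0; congr pair.
by apply/rowP => i; rewrite mxE rV_consS.
Qed.

Section lebesgue_rV_step.
Context n (m : {sigma_finite_measure set 'rV[R]_n -> \bar R}).

Let step : set 'rV[R]_n.+1 -> \bar R :=
  pushforward (@lebesgue_measure R \x m) (@rV_cons R n).

Let step0 : step set0 = 0.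
Proof. by rewrite /step /pushforward preimage_set0 measure0. Qed.

Let step_ge0 A : 0 <= step A.
Proof. exact: (measure_ge0 (@lebesgue_measure R \x m)). Qed.

Let step_sigma_additive : semi_sigma_additive step.
Proof.
exact: (@measure_semi_sigma_additive _ _ _ (measure_function_pushforward__canonical__measure_function_Measure (@lebesgue_measure R \x m) (@measurable_rV_cons R n))).
Qed.

HB.instance Definition _ := isMeasure.Build _ _ _ step
  step0 step_ge0 step_sigma_additive.

Let step_sigma_finite : sigma_finite setT step.
Proof.
have /sigma_finiteP[F [FT ndF Foo]] :=
  @measure_function.sigma_finiteT _ _ _ (@lebesgue_measure R).
have /sigma_finiteP[G [GT ndG Goo]] :=
  @measure_function.sigma_finiteT _ _ _ m.
exists (fun k => @rV_uncons n @^-1` (F k `*` G k)).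
  rewrite -preimage_bigcup (_ : \bigcup_k _ = setT) ?preimage_setT//.
  rewrite -subTset => -[a v] _.
  have [i _ Fi] : (\bigcup_i F i) a by rewrite -FT.
  have [j _ Gj] : (\bigcup_j G j) v by rewrite -GT.
  exists (maxn i j) => //; split.
  - by move: a Fi; exact/subsetPset/ndF/leq_maxl.
  - by move: v Gj; exact/subsetPset/ndG/leq_maxr.
move=> k; have [mF Fk] := Foo k; have [mG Gk] := Goo k; split.
  rewrite -[X in measurable X]setTI; apply: measurable_rV_uncons => //.
  exact: measurableX.
rewrite /step /pushforward -comp_preimage.
rewrite (_ : _ \o _ = id); last by apply/funext => p; exact: rV_consK.
by rewrite preimage_id product_measure1E// lte_mul_pinfty// ge0_fin_numE.
Qed.

HB.instance Definition _ := Measure_isSigmaFinite.Build _ _ _ step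
  step_sigma_finite.

Lemma lebesgue_rV_step :
  exists m' : {sigma_finite_measure set 'rV[R]_n.+1 -> \bar R},
    pushforward (@lebesgue_measure R \x m) (@rV_cons R n) = m'.
Proof. by exists step. Qed.

End lebesgue_rV_step.

Let lebesgue_rV_measure n :
  exists m : {sigma_finite_measure set 'rV[R]_n -> \bar R}, @lebesgue_rV n = m.
Proof.
elim: n => [|n [m /= ->]]; first by exists (\d_(0%R : 'rV[R]_0)).
exact: lebesgue_rV_step.
Qed.

Let lebesgue_rV0 n : @lebesgue_rV n set0 = 0.
Proof. by have [m ->] := lebesgue_rV_measure n. Qed.

Let lebesgue_rV_ge0 n A : 0 <= @lebesgue_rV n A.
Proof. by have [m ->] := lebesgue_rV_measure n. Qed.

Let lebesgue_rV_sigma_additive n : semi_sigma_additive (@lebesgue_rV n).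
Proof.
by have [m ->] := lebesgue_rV_measure n; exact: measure_semi_sigma_additive.
Qed.

HB.instance Definition _ n := isMeasure.Build _ _ _ (@lebesgue_rV n)
  (@lebesgue_rV0 n) (@lebesgue_rV_ge0 n) (@lebesgue_rV_sigma_additive n).

Let lebesgue_rV_sigma_finite n : sigma_finite setT (@lebesgue_rV n).
Proof. by have [m ->] := lebesgue_rV_measure n; exact: sigma_finiteT. Qed.

HB.instance Definition _ n := Measure_isSigmaFinite.Build _ _ _ (@lebesgue_rV n)
  (@lebesgue_rV_sigma_finite n).

Lemma lebesgue_rV_box n (A : 'I_n -> set R) : (forall i, measurable (A i)) ->
  lebesgue_rV [set x : 'rV[R]_n | forall i, A i (x ord0 i)] =
  \prod_(i < n) lebesgue_measure (A i).
Proof.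
elim: n A => [|n ih] A mA.
  by rewrite big_ord0/= diracE mem_set// => -[].
have mB : measurable [set x : 'rV[R]_n | forall i, A (lift ord0 i) (x ord0 i)].
  rewrite (_ : mkset _ =
      \bigcap_(i in setT) ((fun x : 'rV[R]_n => x ord0 i) @^-1` A (lift ord0 i))).
    apply: fin_bigcap_measurable => // i _; rewrite -[X in measurable X]setTI.
    exact: measurable_coord_rV.
  by apply/seteqP; split => x /= h i; [move=> _|]; exact: h.
rewrite big_ord_recl -ih// -product_measure1E//; last exact: mA.
rewrite [LHS]/= /pushforward; congr (product_measure1 _ _ _).
apply/seteqP; split => [p h|p [h0 h] i] /=.
  split; first by have := h ord0; rewrite rV_cons0.
  by move=> i; have := h (lift ord0 i); rewrite rV_consS.
have [->|[j ->]] : i = ord0 \/ exists j, i = lift ord0 j.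
  by case: (unliftP ord0 i) => [j ->|->]; [right; exists j|left].
  by rewrite rV_cons0.
by rewrite rV_consS; exact: h.
Qed.

End lebesgue_rV.
Arguments lebesgue_rV {R} n.

(* [Linfty Omega u] : u represents an element of L^oo(Omega; R^m). The values of
   u outside Omega are irrelevant. Measurability of u is in the sense of
   Lebesgue: u coincides a.e. on Omega with a Borel function, so that this set
   of representatives is closed under a.e. equality on Omega. *)
Definition Linfty (R : realType) (n m : nat) (Omega : set 'rV[R]_n) :
    set ('rV[R]_n -> 'rV[R]_m) :=
  [set u | (exists2 v : 'rV[R]_n -> 'rV[R]_m, measurable_fun Omega v &
              {ae lebesgue_rV n, forall x, Omega x -> u x = v x}) /\
           (exists M : R, {ae lebesgue_rV n, forall x, Omega x -> `|u x| <= M})].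

Definition nonlocal_admissible (R : realType) (n m : nat)
    (Omega : set 'rV[R]_n) (E : set ('rV[R]_m * 'rV[R]_m)) :
    set ('rV[R]_n -> 'rV[R]_m) :=
  [set u | Linfty Omega u /\
    {ae (lebesgue_rV n \x lebesgue_rV n)%E,
      forall xy, (Omega `*` Omega) xy -> E (u xy.1, u xy.2)}].

Definition sym_diag (T : Type) (E : set (T * T)) : set (T * T) :=
  [set p | E p /\ E (p.1, p.1) /\ E (p.2, p.1) /\ E (p.2, p.2)].

(* Main.v *)
Require Import Defs.
From mathcomp Require Import all_boot all_order all_algebra.
From mathcomp Require Import all_classical all_reals all_analysis.
From mathcomp Require Import measurable_realfun.
Import numFieldNormedType.Exports.
Local Open Scope classical_set_scope.

(** The key point is that, for closed [E], the condition on a.e. pair [(x, y)]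
    amounts to a condition on every pair of points off a single null set [N]:
    [nonlocal_admissible_null_set] and its converse
    [nonlocal_admissible_off_null]. As [(x, y)], [(x, x)], [(y, x)] and [(y, y)]
    are all such pairs when [x] and [y] lie off [N], the maps admissible for [E]
    are exactly those admissible for [sym_diag E].

    To find [N], recall that off a null set every value [u x] is essential: the
    preimage of each neighbourhood of [u x] is not negligible
    ([ae_essential_value]). If [x] and [y] have essential values, then for all
    neighbourhoods [U] of [u x] and [V] of [u y] the product of the preimages of
    [U] and [V] is not negligible ([negligible_setX]), so it contains a pair
    whose image is in [E]. Hence [(u x, u y)] is adherent to [E], thus in [E].

    It remains to see that the admissible maps determine [sym_diag E]. If
    [(a, b)] is in [sym_diag E], a map that takes the value [a] on one side of a
    hyperplane and [b] on the other is admissible for [E]. If it is admissible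
    for [F] as well, and both sides meet [Omega] in a non-negligible set, then
    picking a point off [N] on each side gives [(a, b)] in [sym_diag F]. *)

Section nonlocal_inclusion.
Set Implicit Arguments.
Unset Strict Implicit.
Import Order.TTheory GRing.Theory Num.Theory.
Local Open Scope ring_scope.

(** Neither set is assumed measurable: a null set containing [A `*` B] has almost
    all of its sections null, and the section at a point of [A] contains [B]. *)
Lemma negligible_setX d1 d2 (T1 : measurableType d1) (T2 : measurableType d2)
    (R : realType) (mu : {measure set T1 -> \bar R})
    (nu : {sigma_finite_measure set T2 -> \bar R}) (A : set T1) (B : set T2) :
  (mu \x nu)%E.-negligible (A `*` B) ->
  mu.-negligible A \/ nu.-negligible B.
Proof.
move=> [M [mM M0 ABM]].
(* [M] is null, so the integral of [x |-> nu (xsection M x)] vanishes. *)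
have mphi := measurable_fun_xsection nu mM.
have aephi : ae_eq mu setT (nu \o xsection M) (cst 0%E).
  apply/(ae_eq_integral_abs mu measurableT mphi).
  rewrite -[RHS]M0; apply: eq_integral => x _.
  by rewrite gee0_abs.
have [|nB] := pselect (nu.-negligible B); [by right|left].
apply: negligibleS aephi => x Ax /= /(_ I) Mx0; apply: nB.
exists (xsection M x); split => //; first exact: measurable_xsection.
by move=> y By; rewrite /xsection/= inE; exact: ABM.
Qed.

Lemma ae_prod_both d (T : measurableType d) (R : realType)
    (mu : {sigma_finite_measure set T -> \bar R}) (P : T -> Prop) :
  {ae mu, forall x, P x} ->
  {ae (mu \x mu)%E, forall xy, P xy.1 /\ P xy.2}.
Proof.
move=> [N [mN N0 PN]].
exists (N `*` setT `|` setT `*` N); split.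
- by apply: measurableU; exact: measurableX.
- apply/negligibleP; first by apply: measurableU; exact: measurableX.
  apply: negligibleU; apply/negligibleP; try exact: measurableX.
    by apply: etrans (product_measure1E mu mu mN measurableT) _; rewrite [X in (X * _)%E]N0 mul0e.
  by apply: etrans (product_measure1E mu mu measurableT mN) _; rewrite [X in (_ * X)%E]N0 mule0.
- move=> [x y] /= nP; have [Px|nPx] := pselect (P x); [right|left].
    by split=> //; apply: PN => Py; exact: nP.
  by split=> //; apply: PN.
Qed.

(** Almost every value of a map into R^m is essential. No measurability of [f] is
    needed: the exceptional points are covered by the negligible ones among the
    countably many preimages of rational balls. *)
Lemma ae_essential_value d (T : measurableType d) (R : realType) (m : nat)
    (mu : {measure set T -> \bar R}) (D : set T) (f : T -> 'rV[R]_m) :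
  {ae mu, forall x, D x -> forall U, open U -> U (f x) ->
    ~ mu.-negligible (D `&` f @^-1` U)}.
Proof.
pose B (z : 'rV[rat]_m * rat) : set 'rV[R]_m :=
  ball (map_mx ratr z.1 : 'rV[R]_m) (ratr z.2).
(* [G] enumerates the sets [D `&` f @^-1` B z] that are negligible; the
   remaining terms are empty. *)
pose G (k : nat) : set T := if unpickle k is Some z then
  [set x | mu.-negligible (D `&` f @^-1` B z) /\ (D `&` f @^-1` B z) x]
  else set0.
have nG : mu.-negligible (\bigcup_k G k).
  apply: negligible_bigcup => k; rewrite /G.
  case: unpickle => [z|]; last exact: negligible_set0.
  have [nz|nz] := pselect (mu.-negligible (D `&` f @^-1` B z)).
    by apply: negligibleS nz => x [].
  by apply: negligibleS (negligible_set0 mu) => x [].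
apply: negligibleS nG => x /= /not_implyP[Dx].
move=> /existsNP[U] /not_implyP[oU] /not_implyP[Ux] /contrapT nU.
have [q [r [qx qU]]] := open_rV_rat_ball oU Ux.
exists (pickle (q, r)) => //; rewrite /G pickleK /=; split => //.
by apply: negligibleS nU => y [Dy /qU].
Qed.

(** In a product space, a closed set contains every point all of whose
    rectangular open neighbourhoods meet it. *)
Lemma closed_setX_meet (S T : topologicalType) (E : set (S * T)) (p : S * T) :
  closed E ->
  (forall U V, open U -> open V -> U p.1 -> V p.2 -> U `*` V `&` E !=set0) ->
  E p.
Proof.
move=> cE EUV; apply: cE => W [[U V] /= [pU pV] UVW].
have [q [[/= qU qV] Eq]] := EUV _ _ (open_interior U) (open_interior V) pU pV.
by exists q; split => //; apply: UVW; split; exact: interior_subset.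
Qed.

Lemma open_not_negligible_rV (R : realType) (n : nat) (U : set 'rV[R]_n) :
  open U -> U !=set0 -> ~ (lebesgue_rV n).-negligible U.
Proof.
move=> oU [c Uc].
have /nbhs_ballP[e /= e0 eU] : nbhs c U by exact: open_nbhs_nbhs.
pose A (i : 'I_n) : set R := `](c ord0 i - e), (c ord0 i + e)[%classic.
pose box := [set x : 'rV[R]_n | forall i, A i (x ord0 i)].
have bU : box `<=` U.
  move=> x bx; apply: eU; split=> // i j; rewrite ord1.
  by have := bx j; rewrite /A /ball/= in_itv/= ltr_distlC.
have mA i : measurable (A i) by exact: measurable_itv.
have b0 : (0 < lebesgue_rV n box)%E.
  rewrite lebesgue_rV_box//.
  apply: (big_ind (fun t => (0 < t)%E)) => [//|s t|i _]; first exact: mule_gt0.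
  rewrite /A lebesgue_measure_itv/= lte_fin.
  have ce : c ord0 i - e < c ord0 i + e.
    by rewrite ltrD2l (lt_trans _ e0)// oppr_lt0.
  by rewrite ce -EFinB lte_fin subr_gt0.
have mb : measurable box.
  rewrite /box (_ : mkset _ =
      \bigcap_(i in setT) ((fun x : 'rV[R]_n => x ord0 i) @^-1` A i)).
    apply: fin_bigcap_measurable => // i _; rewrite -[X in measurable X]setTI.
    exact: measurable_coord_rV.
  by apply/seteqP; split => x /= h i; [move=> _|]; exact: h.
move=> /(negligibleS bU)/(measure_negligible mb) bz.
by move: b0; rewrite [ltRHS]bz ltxx.
Qed.

Lemma nonlocal_admissible_off_null (R : realType) (n m : nat)
    (Omega N : set 'rV[R]_n) (E : set ('rV[R]_m * 'rV[R]_m))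
    (u : 'rV[R]_n -> 'rV[R]_m) :
  Linfty Omega u -> (lebesgue_rV n).-negligible N ->
  (forall x y, (Omega `\` N) x -> (Omega `\` N) y -> E (u x, u y)) ->
  nonlocal_admissible Omega E u.
Proof.
move=> Lu nN NE; split=> //.
have aeN : {ae lebesgue_rV n, forall x, ~ N x}.
  by apply: negligibleS nN => x /contrapT.
apply: filterS (ae_prod_both aeN) => -[x y] /= [Nx Ny] [Ox Oy].
exact: NE.
Qed.

Lemma nonlocal_admissible_null_set (R : realType) (n m : nat)
    (Omega : set 'rV[R]_n) (E : set ('rV[R]_m * 'rV[R]_m))
    (u : 'rV[R]_n -> 'rV[R]_m) : closed E -> nonlocal_admissible Omega E u ->
  exists2 N, (lebesgue_rV n).-negligible N &
    forall x y, (Omega `\` N) x -> (Omega `\` N) y -> E (u x, u y).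
Proof.
move=> cE [_ aeE].
have := ae_essential_value (lebesgue_rV n) Omega u.
set P := (P in {ae _, forall x, P x}) => aeP; exists (~` [set x | P x]) => //.
move=> x y [Ox /contrapT Px] [Oy /contrapT Py].
apply: closed_setX_meet => // U V oU oV /= Ux Vy.
apply: contrapT => UVE.
suff /negligible_setX[] : (lebesgue_rV n \x lebesgue_rV n)%E.-negligible
    ((Omega `&` u @^-1` U) `*` (Omega `&` u @^-1` V)).
- exact: Px.
- exact: Py.
apply: negligibleS aeE => -[s t] [/= [Os Us] [Ot Vt]] /(_ (conj Os Ot)) Est.
by apply: UVE; exists (u s, u t).
Qed.

Lemma sym_diag_subset (T : Type) (E : set (T * T)) : sym_diag E `<=` E.
Proof. by move=> p []. Qed.

Lemma nonlocal_admissible_sym_diag (R : realType) (n m : nat)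
    (Omega : set 'rV[R]_n) (E : set ('rV[R]_m * 'rV[R]_m)) : closed E ->
  nonlocal_admissible Omega E = nonlocal_admissible Omega (sym_diag E).
Proof.
move=> cE; apply/seteqP; split=> u.
  move=> Au; have [N nN NE] := nonlocal_admissible_null_set cE Au.
  apply: nonlocal_admissible_off_null nN _; first exact: Au.1.
  by move=> x y Nx Ny; do !split; exact: NE.
move=> [Lu aeE]; split=> //.
by apply: filterS aeE => xy Exy /Exy/sym_diag_subset.
Qed.

(** The map with the value [a] on the open half-space of the [x] whose [i]-th
    coordinate is less than [c], and the value [b] on the complement. *)
Definition two_phase (R : realType) (n m : nat) (i : 'I_n) (c : R)
    (a b : 'rV[R]_m) (x : 'rV[R]_n) : 'rV[R]_m :=
  if x ord0 i < c then a else b.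

Lemma two_phase_Linfty (R : realType) (n m : nat) (Omega : set 'rV[R]_n)
    (i : 'I_n) (c : R) (a b : 'rV[R]_m) :
  Linfty Omega (two_phase i c a b).
Proof.
split; last first.
  exists (Num.max `|a| `|b|); apply: aeW => x _; rewrite /two_phase.
  by case: ifP => _; rewrite le_max lexx ?orbT.
exists (two_phase i c a b); last by apply: aeW.
apply: (@measurable_funS _ _ _ _ setT) => //.
apply: measurable_fun_ifT => //.
apply: measurable_fun_ltr => //; exact: measurable_coord_rV.
Qed.

(** Some hyperplane orthogonal to the [i]-th axis leaves a non-negligible part of
    [Omega] on each side: any one through a point of [Omega] does. *)
Lemma open_coord_slices (R : realType) (n : nat) (Omega : set 'rV[R]_n)
    (i : 'I_n) : open Omega -> Omega !=set0 ->
  exists c : R,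
    ~ (lebesgue_rV n).-negligible (Omega `&` [set x | x ord0 i < c]) /\
    ~ (lebesgue_rV n).-negligible (Omega `&` [set x | c < x ord0 i]).
Proof.
move=> oO [z Oz]; exists (z ord0 i).
have /nbhs_ballP[e /= e0 eO] : nbhs z Omega by exact: open_nbhs_nbhs.
have shift (t : R) : `|t| < e -> Omega (z + const_mx t).
  move=> te; apply: eO; split=> // j k.
  by rewrite /ball/= !mxE opprD addNKr normrN.
have e2 : `|e / 2| < e by rewrite gtr0_norm ?divr_gt0// gtr_pMr// invf_lt1 ?ltr1n.
have coo (D : set R) : open D -> open [set x : 'rV[R]_n | D (x ord0 i)].
  by move=> oD; apply: open_comp oD => x _; exact: coord_continuous.
split; apply: open_not_negligible_rV.
- by apply: openI => //; exact: (coo [set t | t < z ord0 i]).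
- exists (z + const_mx (- (e / 2))); split; first by apply: shift; rewrite normrN.
  by rewrite /= !mxE gtrDl oppr_lt0 divr_gt0.
- by apply: openI => //; exact: (coo [set t | z ord0 i < t]).
- exists (z + const_mx (e / 2)); split; first exact: shift.
  by rewrite /= !mxE ltrDl divr_gt0.
Qed.

Lemma sym_diag_subset_admissible (R : realType) (n m : nat)
    (Omega : set 'rV[R]_n) (E F : set ('rV[R]_m * 'rV[R]_m)) :
  (0 < n)%N -> Omega !=set0 -> open Omega -> closed F ->
  nonlocal_admissible Omega E `<=` nonlocal_admissible Omega F ->
  sym_diag E `<=` sym_diag F.
Proof.
move=> n0 O0 oO cF EF [a b] [/= Eab [Eaa [Eba Ebb]]].
have [c [lt_c gt_c]] := open_coord_slices (Ordinal n0) oO O0.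
set i := Ordinal n0 in lt_c gt_c.
pose u := two_phase i c a b.
have /EF : nonlocal_admissible Omega E u.
  split; first exact: two_phase_Linfty.
  apply: aeW => -[x y] _ /=; rewrite /u /two_phase.
  by case: ifP => _; case: ifP.
move=> /(nonlocal_admissible_null_set cF)[N nN NF].
have meet (A : set 'rV[R]_n) : ~ (lebesgue_rV n).-negligible A ->
    exists2 x, A x & ~ N x.
  move=> nA; apply: contrapT => /forall2NP AN; apply: nA.
  by apply: negligibleS nN => x Ax; case: (AN x) => // /contrapT.
have [x [Ox xc] Nx] := meet _ lt_c.
have [y [Oy cy] Ny] := meet _ gt_c.
have <- : u x = a by rewrite /u /two_phase xc.
have <- : u y = b by rewrite /u /two_phase ltNge (ltW cy).
by do !split; exact: NF.
Qed.

End nonlocal_inclusion.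

Theorem proposition5p1 (R : realType) (n m : nat) (hn : (0 < n)%N)
    (Omega : set 'rV[R]_n) (hOmega0 : Omega !=set0)
    (hOmegab : bounded_set Omega) (hOmegao : open Omega)
    (E F : set ('rV[R]_m * 'rV[R]_m)) (hE : closed E) (hF : closed F) :
  (nonlocal_admissible Omega E = nonlocal_admissible Omega F <->
     sym_diag E = sym_diag F) /\
  nonlocal_admissible Omega E = nonlocal_admissible Omega (sym_diag E).
Proof.
split; last exact: nonlocal_admissible_sym_diag.
split=> [EF|EF]; last first.
  by rewrite nonlocal_admissible_sym_diag// EF -nonlocal_admissible_sym_diag.
apply/seteqP; split; apply: sym_diag_subset_admissible (hn) (hOmega0) (hOmegao) _ _ => //.
- by rewrite EF.
- by rewrite EF.
Qed.
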